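(* For all Noetherian spaces $X$ and $Y$, $||X \times Y|| = ||X|| \otimes ||Y||$.
   Context: A topological space is Noetherian if every open subset is compact (every open cover has a finite subcover; no separation is required). $X \times Y$ carries the product topology and is Noetherian when $X$ and $Y$ are. $\otimes$ is the natural (Hessenberg) product of ordinals. For a well-founded poset $P$ and $x \in P$, $\mathrm{rk}_P(x) = \sup_{x' < x} (\mathrm{rk}_P(x')+1)$ and the ordinal rank of $P$ is $|P| = \sup_{x \in P} (\mathrm{rk}_P(x)+1)$, where $\sup\emptyset = 0$. $\mathcal{H}_0 X$ is the poset of all closed subsets of $X$ (including $\emptyset$), ordered by inclusion; it is well-founded when $X$ is Noetherian. The stature of a Noetherian space $X$ is $||X|| = |\mathcal{H}_0 X| - 1$, equivalently $||X|| = \mathrm{rk}_{\mathcal{H}_0 X}(X)$. *)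

(* Defs.v *)
From Stdlib Require Import Sorted Permutation.
From Stdlib Require List.
From HB Require Import structures.
From mathcomp Require Import all_boot all_order finmap.
From mathcomp Require Import boolp classical_sets functions filter topology.

Set Implicit Arguments.
Unset Strict Implicit.
Unset Printing Implicit Defensive.

Local Open Scope classical_set_scope.

(** * Ordinals *)

(** Ordinals are well-founded trees: [osup f] denotes the least ordinal strictly
    above all the [f i], i.e. sup_i (f i + 1).  Several trees may denote the same
    ordinal, so equality of ordinals is [oeq], not [=]. *)
Inductive Ord : Type := osup (I : Type) (f : I -> Ord).

(* a <= sup_j (g j + 1) iff every f i < a satisfies f i <= g j for some j *)
Fixpoint ole (a b : Ord) {struct a} : Prop :=
  match a, b with
  | osup A f, osup B g => forall i, exists j, ole (f i) (g j)
  end.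

Definition olt (a b : Ord) : Prop :=
  match b with osup B g => exists j, ole a (g j) end.

Definition oeq (a b : Ord) : Prop := ole a b /\ ole b a.

Definition ozero : Ord := osup (fun e : void => match e with end).

Definition osucc (a : Ord) : Ord := osup (fun _ : unit => a).

(** a + b is the least ordinal above every a' < a and every a + b' for b' < b. *)
Fixpoint oadd (a b : Ord) {struct b} : Ord :=
  match a, b with
  | osup A f, osup B g =>
      osup (fun k : A + B => match k with inl i => f i | inr j => oadd a (g j) end)
  end.

(* a * n, for a finite n *)
Definition omuln (a : Ord) (n : nat) : Ord := iter n (oadd a) ozero.

(** omega^a is the least ordinal above 0 and every omega^a' * n, for a' < a and
    n finite; [oexpw0] and [oexpwS] below give its first two recursion equations. *)
Fixpoint oexpw (a : Ord) : Ord :=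
  match a with
  | osup A f => osup (fun k : option (A * nat) =>
      if k is Some (i, n) then omuln (oexpw (f i)) n else ozero)
  end.

Lemma ole_refl a : ole a a.
Proof. by elim: a => I f IH /= i; exists i. Qed.
#[local] Hint Resolve ole_refl : core.

Lemma ole_trans b a c : ole a b -> ole b c -> ole a c.
Proof.
elim: a b c => I f IH [J g] [K h] /= H1 H2 i.
have [j Hj] := H1 i; have [k Hk] := H2 j.
by exists k; apply: IH Hj Hk.
Qed.

Lemma ole_lt_trans b a c : ole a b -> olt b c -> olt a c.
Proof. by case: c => K h /= H [k Hk]; exists k; apply: ole_trans Hk. Qed.

Lemma olt_le_trans b a c : olt a b -> ole b c -> olt a c.
Proof.
case: b c => J g [K h] /= [j Hj] H; have [k Hk] := H j.
by exists k; apply: ole_trans Hk.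
Qed.

Lemma oleP I (f : I -> Ord) b : ole (osup f) b <-> forall i, olt (f i) b.
Proof. by case: b. Qed.

Lemma olt_sup I (f : I -> Ord) i : olt (f i) (osup f).
Proof. by exists i. Qed.

Lemma oltW a b : olt a b -> ole a b.
Proof.
elim: a b => I f IH [J g] /= [j Hj] i.
exists j; apply: IH; exact: olt_le_trans (olt_sup f i) Hj.
Qed.

Lemma oltNge a b : olt a b <-> ~ ole b a.
Proof.
split; last first.
  elim: a b => I f IH [J g] H.
  have [j Hj] : exists j, ~ exists i, ole (g j) (f i).
    exact/existsNP.
  exists j; apply/oleP => i.
  by apply: IH => H'; apply: Hj; exists i.
elim: a b => I f IH [J g] /= [j Hj] H.
have [i Hi] := H j.
exact: (IH i (g j)) (olt_le_trans (olt_sup f i) Hj) Hi.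
Qed.

Lemma ole_lt a b : ole a b \/ olt b a.
Proof. by have [?|?] := pselect (ole a b); [left|right; apply/oltNge]. Qed.

Lemma ole0 a : ole ozero a.
Proof. by case: a => I f []. Qed.

Lemma oeq_refl a : oeq a a. Proof. by []. Qed.

Lemma oeq_sym a b : oeq a b -> oeq b a. Proof. by case. Qed.

Lemma oeq_trans b a c : oeq a b -> oeq b c -> oeq a c.
Proof. by move=> [? ?] [? ?]; split; apply: (@ole_trans b). Qed.

Lemma ole_add a b c : ole b c -> ole (oadd a b) (oadd a c).
Proof.
case: a => I f; elim: b c => J g IH [K h] H /= [i|j]; first by exists (inl i).
by have [k /IH Hk] := H j; exists (inr k).
Qed.

Lemma olt_add a b c : olt b c -> olt (oadd a b) (oadd a c).
Proof.
case: c => K h [k /(ole_add a) Hk]; apply: ole_lt_trans Hk _.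
by case: a => I f; exists (inr k).
Qed.

Lemma ole_add_cancel a b c : ole (oadd a b) (oadd a c) -> ole b c.
Proof. by have [//|/(olt_add a)/oltNge] := ole_lt b c. Qed.

Lemma ole_addr a b : ole a (oadd a b).
Proof. by case: a b => I f [J g] /= i; exists (inl i). Qed.

Lemma oadd0 a : oeq (oadd a ozero) a.
Proof.
split; last exact: ole_addr.
by case: a => I f /= [i|[]]; exists i.
Qed.

Lemma oaddS a b : oeq (oadd a (osucc b)) (osucc (oadd a b)).
Proof.
case: a => I f; split.
- move=> /= -[i|[]]; exists tt => //.
  exact: oltW (olt_le_trans (olt_sup f i) (ole_addr (osup f) b)).
- by move=> /= []; exists (inr tt) => /=.
Qed.

Lemma oexpw0 : oeq (oexpw ozero) (osucc ozero).
Proof. by split=> /= [[[[]]|]|[]]; [exists tt|exists None]. Qed.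

Lemma oexpwS a : oeq (oexpw (osucc a)) (osup (omuln (oexpw a))).
Proof.
split.
- by move=> /= [[[] n]|]; [exists n|exists 0].
- by move=> /= n; exists (Some (tt, n)).
Qed.

Fixpoint osub (x a : Ord) {struct a} : Ord :=
  match a with
  | osup B g => osup (fun j : {j : B | ole x (g j)} => osub x (g (sval j)))
  end.

Lemma osubK x a : ole x a -> oeq a (oadd x (osub x a)).
Proof.
elim: a => J g IH Hx; split.
- apply/oleP => j; have [xj|jx] := ole_lt x (g j); last first.
    exact: olt_le_trans jx (ole_addr _ _).
  apply: ole_lt_trans (proj1 (IH j xj)) _; apply: olt_add.
  by exists (exist _ j xj).
- case: x Hx IH => I f Hx IH /= [i|[j xj]].
    exact: olt_le_trans (olt_sup f i) Hx.
  exact: ole_lt_trans (proj2 (IH j xj)) (olt_sup g j).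
Qed.

Lemma ole_expw a : ole a (oexpw a).
Proof.
elim: a => I f IH; apply/oleP => i.
exists (Some (i, 1)); apply: ole_trans (IH i) _; exact: ole_addr.
Qed.

(** ** Cantor normal forms and the natural operations *)

Definition oge (a b : Ord) : Prop := ole b a.

(* omega^a_1 + ... + omega^a_n *)
Definition cnf_val (s : seq Ord) : Ord := foldr (fun a => oadd (oexpw a)) ozero s.

Definition is_cnf (a : Ord) (s : seq Ord) : Prop :=
  Sorted oge s /\ oeq a (cnf_val s).

Lemma cnf_exists a : exists s, is_cnf a s.
Proof.
suff H : forall c b, ole b (oexpw c) -> exists s, is_cnf b s.
  exact: (H a a (ole_expw a)).
have Hlt c : forall b, olt b (oexpw c) ->
    exists s, [/\ is_cnf b s & forall x, List.In x s -> olt x c].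
  elim: c => I f IH b [[[i n]|]] Hb; last first.
    exists [::]; split=> //; split=> //; split=> //; exact: ole0.
  suff [s [Hs Hx]] : exists s, [/\ is_cnf b s &
      forall x, List.In x s -> ole x (f i)].
    by exists s; split=> // x /Hx; exists i.
  elim: n b Hb => [|n IHn] b Hb.
    exists [::]; split=> //; split=> //; split=> //; exact: ole0.
  have [wb|bw] := ole_lt (oexpw (f i)) b; last first.
    have [s [Hs Hx]] := IH i b bw.
    by exists s; split=> // x /Hx/oltW.
  have [Hb1 Hb2] := osubK wb.
  have /IHn [s [[s_sort [s1 s2]] Hx]] : ole (osub (oexpw (f i)) b)
      (omuln (oexpw (f i)) n).
    by apply: (@ole_add_cancel (oexpw (f i))); apply: ole_trans Hb2 Hb.
  exists (f i :: s); split; last by move=> x /= [<-|/Hx].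
  split; last first.
    split; first by apply: ole_trans Hb1 _; apply: ole_add.
    by apply: ole_trans Hb2; apply: ole_add.
  apply: Sorted_cons => //; case: s {s_sort s1 s2} Hx => [|x s] Hx; constructor.
  by apply: Hx; left.
move=> c b Hb.
have /Hlt [s [Hs _]] : olt b (oexpw (osucc c)).
  exists (Some (tt, 1)); apply: ole_trans Hb _; exact: ole_addr.
by exists s.
Qed.

(* Unique up to [oeq] of the exponents. *)
Definition cnf (a : Ord) : seq Ord := sval (cid (cnf_exists a)).

Lemma cnfP a : is_cnf a (cnf a).
Proof. exact: svalP (cid (cnf_exists a)). Qed.

(* Insertion sort.  [sort] and [sorted] from path are not used because their
   universe constraints would force the index types of [osup] to be too small
   to contain the carrier of a [topologicalType]. *)
Fixpoint oinsert (a : Ord) (s : seq Ord) : seq Ord :=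
  match s with
  | [::] => [:: a]
  | b :: s' => if pselect (oge a b) then a :: s else b :: oinsert a s'
  end.

Definition osort (s : seq Ord) : seq Ord := foldr oinsert [::] s.

Lemma osort_sorted s : Sorted oge (osort s).
Proof.
elim: s => [|a s IH] /=; first exact: Sorted_nil.
elim: (osort s) IH => [|b t IHt] /= H; first by repeat constructor.
case: pselect => [ab|nab]; first by apply: Sorted_cons H _; apply: HdRel_cons.
have ba : oge b a by have [/nab//|/oltW] := ole_lt b a.
have [Ht Hbt] := Sorted_inv H; constructor; first exact: IHt.
case: t Hbt {IHt H Ht} => [|c t] Hbt /=; first by constructor.
case: pselect => ? /=; constructor=> //; exact: HdRel_inv Hbt.
Qed.

Lemma osort_perm s : Permutation (osort s) s.
Proof.
elim: s => [|a s IH] //=; apply: (@Permutation.perm_trans _ _ (a :: osort s)); last first.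
  exact: perm_skip.
elim: (osort s) => [|b t IHt] //=; case: pselect => // ? /=.
apply: (@Permutation.perm_trans _ _ (b :: a :: t)); last exact: perm_swap.
exact: perm_skip.
Qed.

(** Natural (Hessenberg) sum: the terms of both Cantor normal forms, in
    non-increasing order of exponents. *)
Definition hadd (a b : Ord) : Ord := cnf_val (osort (cnf a ++ cnf b)).

(** Natural (Hessenberg) product: the natural sum of the
    omega^(a_i natural-plus b_j). *)
Definition hmul (a b : Ord) : Ord :=
  foldr hadd ozero [seq oexpw (hadd x y) | x <- cnf a, y <- cnf b].

(** * Ranks *)

Section Rank.
Variables (P : Type) (lt : P -> P -> Prop) (wf : well_founded lt).

Definition rk : P -> Ord :=
  Fix wf (fun _ => Ord)
    (fun x rec => osup (fun y : {y | lt y x} => rec (sval y) (svalP y))).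

Lemma rkE x : rk x = osup (fun y : {y | lt y x} => rk (sval y)).
Proof.
rewrite /rk Fix_eq // => {}x f g fg; congr osup.
by apply/funext => y; rewrite fg.
Qed.

Definition orank : Ord := osup rk.

End Rank.

(** * Noetherian spaces and their statures *)

(* [cover_compact]: every open cover has a finite subcover *)
Definition noetherian (X : topologicalType) : Prop :=
  forall U : set X, open U -> cover_compact U.

(* [compact_cover] of the library, without its assumption that T is pointed *)
Lemma compact_coverE (T : topologicalType) (A : set T) :
  compact A <-> cover_compact A.
Proof.
have [[x Ax]|/nonemptyPn ->] := pselect (A !=set0).
  pose Tp : ptopologicalType := HB.pack T (isPointed.Build T x).
  have E : compact A = cover_compact A := congr1 (@^~ A) (@compact_cover Tp).
  by rewrite E.
split=> [_|_]; last exact: compact0.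
by move=> I D f _ _; exists fset0 => //; apply: sub0set.
Qed.

Lemma noetherian_ultra (X : topologicalType) : noetherian X ->
  forall (F : set_system X) (A : set X), UltraFilter F -> F A ->
  A `&` [set p | F --> p] !=set0.
Proof.
move=> nX F A UF FA; apply: contrapT => /nonemptyPn A0.
pose O := \bigcup_(U in [set U | open U /\ ~ F U]) U.
have oO : open O by apply: bigcup_open => U [].
have AO : A `<=` O.
  move=> x Ax; apply: contrapT => NOx.
  suff : set0 x by [].
  rewrite -A0; split=> // B; rewrite nbhsE => -[U [oU Ux] UB].
  apply: contrapT => NFB; apply: NOx; exists U => //; split=> // FU.
  by apply: NFB; apply: filterS FU.
have FO : F O by apply: filterS FA.
have := nX O oO => /compact_coverE; rewrite compact_ultra => /(_ F UF FO).
move=> [y [[U [oU NFU] Uy] Fy]]; apply: NFU; apply: Fy.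
exact: open_nbhs_nbhs.
Qed.

Lemma noetherian_prod (X Y : topologicalType) :
  noetherian X -> noetherian Y -> noetherian (X * Y)%type.
Proof.
move=> nX nY W _; apply/compact_coverE; rewrite compact_ultra => F UF FW.
have PF : ProperFilter F by exact: ultra_proper.
have ultra_map (Z : topologicalType) (g : (X * Y)%type -> Z) :
    UltraFilter (g @ F).
  apply: (@Build_UltraFilter _ _ (fmap_proper_filter g PF)) => G PG FG.
  apply/seteqP; split=> // A GA.
  have [//|FnA] := in_ultra_setVsetC (g @^-1` A) UF.
  have : G (A `&` ~` A) by apply: filterI => //; apply: FG.
  by rewrite setICr => /filter_not_empty.
have lim_mem (Z : topologicalType) (g : (X * Y)%type -> Z) :
    noetherian Z -> F (g @^-1` [set p | g @ F --> p]).
  move=> nZ; have [//|FnL] := in_ultra_setVsetC (g @^-1` [set p | g @ F --> p]) UF.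
  have [z []] := @noetherian_ultra Z nZ (g @ F) (~` [set p | g @ F --> p])
    (ultra_map Z g) FnL.
  by [].
have [[x y] [Wxy [/= Fx Fy]]] := filter_ex
  (filterI FW (filterI (lim_mem X fst nX) (lim_mem Y snd nY))).
exists (x, y); split=> //= A [[B C] /= [xB yC] BCA].
have FB : F (fst @^-1` B) := Fx _ xB.
have FC : F (snd @^-1` C) := Fy _ yC.
by apply: (filterS _ (filterI FB FC)) => -[u v] [/= Bu Cv]; apply: BCA.
Qed.

(** The closed subsets of X, including the empty one. *)
Definition hoare (X : topologicalType) : Type := {F : set X | closed F}.

Definition hoare_lt (X : topologicalType) (F G : hoare X) : Prop :=
  sval F `<` sval G.

Definition hoareT (X : topologicalType) : hoare X := exist _ setT closedT.

Lemma hoare_wf (X : topologicalType) : noetherian X -> well_founded (@hoare_lt X).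
Proof.
move=> nX F0; apply: contrapT => F0N.
have step (F : {F : hoare X | ~ Acc (@hoare_lt X) F}) :
    {G : {F : hoare X | ~ Acc (@hoare_lt X) F} | hoare_lt (sval G) (sval F)}.
  apply: cid; case: F => F FN; apply: contrapT => H; apply: (FN); constructor=> G GF.
  by apply: contrapT => GN; apply: H; exists (exist _ G GN).
pose u n : hoare X := sval (iter n (fun F => sval (step F)) (exist _ F0 F0N)).
have ulta n : sval (u n.+1) `<` sval (u n) by exact: svalP (step _).
have udec m n : (m <= n)%N -> sval (u n) `<=` sval (u m).
  move=> /subnKC <-; elim: (n - m)%N => [|k IH]; first by rewrite addn0.
  by rewrite addnS; apply: subset_trans IH; case: (ulta (m + k)).
pose V n := ~` sval (u n).
have oV n : open (V n) by rewrite openC; exact: svalP (u n).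
have [D' _ D'V] := nX _ (bigcup_open (fun n (_ : setT n) => oV n)) nat setT V
  (fun n _ => oV n) (fun x Vx => Vx).
pose N := \max_(i <- D') i.
have [_] := ulta N; apply=> x uNx; apply: contrapT => NuSx.
have [i iD' Vix] : cover [set` D'] V x by apply: D'V; exists N.+1.
by apply: Vix; apply: udec uNx; apply: leq_bigmax_seq.
Qed.

Definition stature (X : topologicalType) (nX : noetherian X) : Ord :=
  rk (hoare_wf nX) (hoareT X).

(* |H_0 X| = ||X|| + 1 *)
Lemma orank_hoare (X : topologicalType) (nX : noetherian X) :
  oeq (orank (hoare_wf nX)) (osucc (stature nX)).
Proof.
split; last by move=> /= []; exists (hoareT X); exact: ole_refl.
move=> /= F; exists tt; rewrite /stature rkE [X in ole _ X]rkE => -[G GF].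
have GT : hoare_lt G (hoareT X).
  by split=> // TG; case: GF => _; apply=> x _; apply: TG.
exists (exist _ G GT); exact: ole_refl.
Qed.

(* Main.v *)
From Stdlib Require Import Sorted Permutation Wellfounded.
From mathcomp Require Import all_boot zify boolp classical_sets.
Require Import Defs.
From mathcomp Require Import topology.

Set Implicit Arguments.
Unset Strict Implicit.
Unset Printing Implicit Defensive.

Local Open Scope classical_set_scope.

(** The proof follows the de Jongh-Parikh computation of the maximal order type
    of a product, with relatively closed subsets of arbitrary subsets in place
    of downward closed sets.

    Every subset [A] of a Noetherian space has a stature [stat A], the rank of
    [A] among its relatively closed subsets.  Two inequalities carry everything:
    statures are subadditive for the natural sum ([statU]), and if [C] is
    relatively closed in [A], then stat C + stat (A \ C) <= stat A for the
    ordinary sum ([stat_closed_add]).  As a rank takes every smaller value on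
    smaller elements, a subset whose stature is omega^a_1 + ... + omega^a_n in
    Cantor normal form can be cut into successive pieces of statures
    omega^a_1, ..., omega^a_n, every initial union of pieces being relatively
    closed ([stat_split] and [stat_pieces] give the bounds from above and from
    below that are used).

    For pieces of statures omega^a and omega^b the product has stature
    omega^(a (+) b), where (+) is the natural sum.  Both bounds ([stat_setX_le],
    [stat_setX_ge]) are inductions on the exponents; the upper one uses that
    omega^c is closed under natural sums, the lower one that an ordinal below
    a (+) b is bounded by lowering [a] or [b].

    In general, let a_i and b_j be the exponents of the two spaces.  The product
    is cut into blocks, and subadditivity bounds its stature by the natural sum
    of all omega^(a_i (+) b_j), which is the natural product.  For the converse,
    add the blocks one at a time by decreasing exponent.  Exponents decrease in
    i and in j, so the union of the blocks added so far can be kept a staircase,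
    hence relatively closed; each block then contributes to an ordinary sum
    ([stat_staircase]), and that sum is the natural one since its exponents
    decrease. *)

(** * Ordinal arithmetic *)

Lemma olt_irr a : ~ olt a a.
Proof. by move/oltNge; apply; apply: ole_refl. Qed.

Lemma ole_oadd a a' b b' : ole a a' -> ole b b' -> ole (oadd a b) (oadd a' b').
Proof.
move=> aa' bb'; apply: ole_trans (ole_add a' bb') => {b' bb'}.
elim: b => J g IH; case: a a' aa' IH => I f [I' f'] aa' IH /= [i|j].
  by have [i' ?] := aa' i; exists (inl i').
by exists (inr j); apply: IH.
Qed.

Lemma olt_oaddr a b : olt ozero b -> olt a (oadd a b).
Proof. by move=> b0; apply: ole_lt_trans (oadd0 a).2 (olt_add a b0). Qed.

Lemma olt_oadd_inv c a b : olt c (oadd a b) ->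
  olt c a \/ exists2 b', olt b' b & ole c (oadd a b').
Proof.
case: a b => I f [J g] /= [[i|j]] H; first by left; exists i.
by right; exists (g j) => //; apply: olt_sup.
Qed.

Lemma oadd0l a : oeq (oadd ozero a) a.
Proof.
elim: a => I f IH; split.
  by move=> /= [[]|i]; exists i; apply: (IH i).1.
by move=> /= i; exists (inr i); apply: (IH i).2.
Qed.

Lemma oaddA a b c : oeq (oadd a (oadd b c)) (oadd (oadd a b) c).
Proof.
elim: c => K h IH; case: a b IH => I f [J g] IH; split.
  move=> /= [i|[j|k]].
  - by exists (inl (inl i)); apply: ole_refl.
  - by exists (inl (inr j)); apply: ole_refl.
  - by exists (inr k); apply: (IH k).1.
move=> /= [[i|j]|k].
- by exists (inl i); apply: ole_refl.
- by exists (inr (inl j)); apply: ole_refl.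
- by exists (inr (inr k)); apply: (IH k).2.
Qed.

Lemma omuln1 a : oeq (omuln a 1) a.
Proof. exact: oadd0. Qed.

Lemma omulnSr a n : oeq (omuln a n.+1) (oadd (omuln a n) a).
Proof.
elim: n => [|n IH].
  by apply: oeq_trans (omuln1 a) _; apply: oeq_sym; apply: oadd0l.
rewrite [omuln a n.+2]/=; apply: oeq_trans (oaddA _ _ _).
by split; apply: ole_add; [apply: IH.1|apply: IH.2].
Qed.

Lemma leq_omuln a m n : m <= n -> ole (omuln a m) (omuln a n).
Proof.
move=> /subnKC <-; elim: (n - m) => [|k IH]; first by rewrite addn0; apply: ole_refl.
rewrite addnS; apply: ole_trans IH _; apply: ole_trans (omulnSr _ _).2.
exact: ole_addr.
Qed.

Lemma ole_omuln a b n : ole a b -> ole (omuln a n) (omuln b n).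
Proof.
by move=> ab; elim: n => [|n IH]; [apply: ole_refl|apply: (ole_oadd ab IH)].
Qed.

(** Euclidean division by [w]. *)
Lemma omuln_div w n b : olt b (omuln w n) ->
  exists k r, [/\ (k < n)%N, olt r w & oeq b (oadd (omuln w k) r)].
Proof.
elim: n b => [|n IH] b; first by case.
have [wb|bw] := ole_lt (omuln w n) b => Hb.
  exists n, (osub (omuln w n) b); have [H1 H2] := osubK wb.
  split=> //; apply/oltNge => /(ole_add (omuln w n)) H; apply/(@olt_irr b).
  apply: olt_le_trans Hb _; apply: ole_trans (omulnSr _ _).1 _.
  exact: ole_trans H H2.
by have [k [r [kn rw E]]] := IH b bw; exists k, r; split=> //; apply: leqW.
Qed.

(** * The natural sum by recursion *)

(** The Hessenberg sum: the least binary operation on ordinals that is strictly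
    increasing in each argument.  In this form strict monotonicity is immediate,
    and an ordinal below [nadd a b] is bounded by lowering one argument; these
    are the two properties that an induction on closed sets can use.  The
    agreement with the Cantor normal form description is [hadd_nadd]. *)
Fixpoint nadd (a : Ord) : Ord -> Ord :=
  match a with
  | osup A f => fix nadd_a (b : Ord) : Ord :=
      match b with
      | osup B g => osup (fun k : A + B =>
          match k with inl i => nadd (f i) b | inr j => nadd_a (g j) end)
      end
  end.

Lemma ole_nadd a a' b b' : ole a a' -> ole b b' -> ole (nadd a b) (nadd a' b').
Proof.
elim: a a' b b' => I f IHa [I' f'] b b' aa'.
elim: b b' => J g IHb [J' g'] bb' /= [i|j].
  have [i' ii'] := aa' i; exists (inl i'); exact: IHa.
have [j' jj'] := bb' j; exists (inr j'); exact: (IHb j).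
Qed.

Lemma oeq_nadd a a' b b' : oeq a a' -> oeq b b' -> oeq (nadd a b) (nadd a' b').
Proof. by move=> [? ?] [? ?]; split; apply: ole_nadd. Qed.

Lemma olt_naddl a a' b : olt a a' -> olt (nadd a b) (nadd a' b).
Proof.
case: a' b => I' f' [J g] [i Hi]; exists (inl i).
exact: (ole_nadd Hi (ole_refl (osup g))).
Qed.

Lemma olt_naddr a b b' : olt b b' -> olt (nadd a b) (nadd a b').
Proof.
case: a b' => I f [J' g'] [j Hj]; exists (inr j).
exact: (ole_nadd (ole_refl (osup f)) Hj).
Qed.

Lemma naddC_le a b : ole (nadd a b) (nadd b a).
Proof.
elim: a b => I f IHa; elim=> J g IHb /= [i|j].
  by exists (inr i); apply: (IHa i (osup g)).
by exists (inl j); apply: (IHb j).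
Qed.

Lemma naddC a b : oeq (nadd a b) (nadd b a).
Proof. by split; apply: naddC_le. Qed.

Lemma naddA_le a b c : ole (nadd (nadd a b) c) (nadd a (nadd b c)).
Proof.
elim: a b c => I f IHa; elim=> J g IHb; elim=> K h IHc /= [[i|j]|k].
- by exists (inl i); apply: (IHa i (osup g) (osup h)).
- by exists (inr (inl j)); apply: (IHb j (osup h)).
- by exists (inr (inr k)); apply: (IHc k).
Qed.

Lemma naddA a b c : oeq (nadd a (nadd b c)) (nadd (nadd a b) c).
Proof.
split; last exact: naddA_le.
apply: ole_trans (naddC_le _ _) _.
apply: ole_trans (ole_nadd (naddC_le _ _) (ole_refl _)) _.
apply: ole_trans (naddA_le _ _ _) _.
apply: ole_trans (naddC_le _ _) _.
exact: ole_nadd (naddC_le _ _) (ole_refl _).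
Qed.

Lemma nadd0 a : oeq (nadd ozero a) a.
Proof.
elim: a => I f IH; split.
  by move=> /= [[]|i]; exists i; apply: (IH i).1.
by move=> /= i; exists (inr i); apply: (IH i).2.
Qed.

Lemma ole_oadd_nadd a b : ole (oadd a b) (nadd a b).
Proof.
elim: b => J g IH; case: a IH => I f IH /= [i|j].
  exists (inl i); apply: ole_trans (ole_nadd (ole_refl _) (ole0 (osup g))).
  exact: ole_trans (nadd0 _).2 (naddC_le _ _).
by exists (inr j); apply: IH.
Qed.

Definition nadd_closed w := forall r s, olt r w -> olt s w -> olt (nadd r s) w.

Lemma olt_omuln_add w k r c : olt c (oadd (omuln w k) r) ->
  (exists2 r', olt r' r & ole c (oadd (omuln w k) r')) \/
  (exists k' r', [/\ (k' < k)%N, olt r' w & ole c (oadd (omuln w k') r')]).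
Proof.
case/olt_oadd_inv => [/omuln_div [k' [r' [? ? []]]]|]; last by left.
by right; exists k', r'.
Qed.

(** No carry occurs among the remainders when [w] is closed under natural sums,
    so quotients and remainders add up separately: decreasing a remainder decreases the
    sum of the remainders, and decreasing a quotient leaves room for any sum of
    remainders, which stays below [w]. *)
Lemma nadd_omuln w k l r s : nadd_closed w -> olt r w -> olt s w ->
  ole (nadd (oadd (omuln w k) r) (oadd (omuln w l) s))
      (oadd (omuln w (k + l)) (nadd r s)).
Proof.
move=> Hw rw sw.
have carry k' l' m r' s' : (k' + l' < m)%N -> olt r' w -> olt s' w ->
    olt (oadd (omuln w (k' + l')) (nadd r' s')) (omuln w m).
  move=> lt_m r'w s'w; apply: olt_le_trans (leq_omuln w lt_m).
  apply: olt_le_trans (omulnSr _ _).2; apply: olt_add; exact: Hw.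
(* Bounds instead of equations let the induction run on the trees [a] and [b]. *)
suff H a b : ole a (oadd (omuln w k) r) -> ole b (oadd (omuln w l) s) ->
    ole (nadd a b) (oadd (omuln w (k + l)) (nadd r s)).
  by apply: H; apply: ole_refl.
elim: a b k l r s rw sw => I f IHa; elim=> J g IHb k l r s rw sw Ha Hb.
apply/oleP => -[i|j].
  have [[r' r'r]|[k' [r' [k'k r'w]]]] := olt_omuln_add (olt_le_trans (olt_sup f i) Ha).
    move=> /(IHa i _ k l r' s) H.
    apply: ole_lt_trans (H (osup g) (olt_le_trans r'r (oltW rw)) sw Hb) _.
    by apply: olt_add; apply: olt_naddl.
  move=> /(IHa i _ k' l r' s) H; apply: ole_lt_trans (H (osup g) r'w sw Hb) _.
  apply: olt_le_trans (ole_addr _ _); apply: carry => //.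
  by rewrite ltn_add2r.
have [[r' r'r]|[k' [r' [k'k r'w]]]] := olt_omuln_add (olt_le_trans (olt_sup g j) Hb).
  move=> H.
  apply: ole_lt_trans (IHb j k l r r' rw (olt_le_trans r'r (oltW sw)) Ha H) _.
  by apply: olt_add; apply: olt_naddr.
move=> H; apply: ole_lt_trans (IHb j k k' r r' rw r'w Ha H) _.
apply: olt_le_trans (ole_addr _ _); apply: carry => //.
by rewrite ltn_add2l.
Qed.

Lemma oexpw_gt0 a : olt ozero (oexpw a).
Proof. by case: a => I f; exists None; apply: ole_refl. Qed.

Lemma ole_oexpw a b : ole a b -> ole (oexpw a) (oexpw b).
Proof.
elim: a b => I f IH [J g] H /= [[i m]|]; last by exists None; apply: ole_refl.
have [j Hj] := H i; exists (Some (j, m)); apply: ole_omuln; exact: IH.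
Qed.

Lemma olt_oexpw_omuln a b n : olt a b -> olt (omuln (oexpw a) n) (oexpw b).
Proof.
by case: b => I f [i /ole_oexpw H]; exists (Some (i, n)); apply: ole_omuln.
Qed.

Lemma olt_oexpw_inv c b : olt c (oexpw b) ->
  ole c ozero \/ exists2 a, olt a b & exists n, ole c (omuln (oexpw a) n).
Proof.
case: b => I f [[[i n]|]] H; last by left.
by right; exists (f i); [apply: olt_sup|exists n].
Qed.

Lemma nadd_closed_omuln w k l : nadd_closed w -> olt ozero w ->
  ole (nadd (omuln w k) (omuln w l)) (omuln w (k + l)).
Proof.
move=> Hw w0; apply: ole_trans (ole_nadd (oadd0 _).2 (oadd0 _).2) _.
apply: ole_trans (nadd_omuln k l Hw w0 w0) _.
apply: ole_trans (ole_add _ (nadd0 _).1) _; exact: (oadd0 _).1.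
Qed.

(** Two ordinals below omega^a are both at most omega^e * n for a common e < a,
    and by induction omega^e satisfies the hypothesis of [nadd_omuln]. *)
Lemma nadd_closed_oexpw a : nadd_closed (oexpw a).
Proof.
suff H b : ole b a -> nadd_closed (oexpw b) by apply: H; apply: ole_refl.
elim: a b => I f IH b ba r s /olt_oexpw_inv [r0|[c cb [m rm]]].
  move=> sb; apply: ole_lt_trans sb.
  by apply: ole_trans (ole_nadd r0 (ole_refl s)) _; apply: (nadd0 s).1.
move=> /olt_oexpw_inv [s0|[d db [n sn]]].
  apply: ole_lt_trans (olt_oexpw_omuln m cb).
  apply: ole_trans (ole_nadd rm s0) _; apply: ole_trans (naddC_le _ _) _.
  exact: (nadd0 _).1.
have [e [eb ce de]] : exists e, [/\ olt e b, ole c e & ole d e].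
  have [cd|/oltW dc] := ole_lt c d; [exists d|exists c]; split=> //; exact: ole_refl.
have [i ei] : exists i, ole e (f i) by exact: (olt_le_trans eb ba).
apply: ole_lt_trans (olt_oexpw_omuln (m + n) eb).
apply: ole_trans (nadd_closed_omuln m n (IH i e ei) (oexpw_gt0 e)).
by apply: ole_nadd; [apply: ole_trans rm _|apply: ole_trans sn _];
  apply: ole_omuln; apply: ole_oexpw.
Qed.

(** When no exponent of [b] exceeds [a], putting omega^a in front of [b] respects
    the order of exponents, so ordinary and natural sum agree. *)
Lemma nadd_oexpw_absorb a b n : ole b (omuln (oexpw a) n) ->
  ole (nadd (oexpw a) b) (oadd (oexpw a) b).
Proof.
set w := oexpw a => bn.
have Hw : nadd_closed w by exact: nadd_closed_oexpw.
have w0 : olt ozero w by exact: oexpw_gt0.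
have [l [r [_ rw [E1 E2]]]] : exists l r,
    [/\ (l < n.+1)%N, olt r w & oeq b (oadd (omuln w l) r)].
  apply: omuln_div; apply: ole_lt_trans bn _.
  exact: olt_le_trans (olt_oaddr _ w0) (omulnSr w n).2.
apply: (@ole_trans (nadd (oadd (omuln w 1) ozero) (oadd (omuln w l) r))).
  by apply: ole_nadd E1; apply: ole_trans (oadd0 _).2; apply: (omuln1 w).2.
apply: ole_trans (nadd_omuln 1 l Hw w0 rw) _.
apply: ole_trans (ole_add _ (nadd0 r).1) _.
by apply: ole_trans (oaddA _ _ _).2 _; apply: ole_add.
Qed.

(** * Natural sums, natural products and Cantor normal forms *)

Definition nsum (s : seq Ord) : Ord := foldr nadd ozero s.

Lemma nsum_cat s t : oeq (nsum (s ++ t)) (nadd (nsum s) (nsum t)).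
Proof.
elim: s => [|a s IH] /=; first exact/oeq_sym/nadd0.
apply: oeq_trans (naddA _ _ _).
exact: oeq_nadd (oeq_refl a) IH.
Qed.

Lemma nsum_perm s t : Permutation s t -> oeq (nsum s) (nsum t).
Proof.
elim=> {s t} [|a s t _ IH|a b s|s t u _ IH1 _ IH2].
- exact: oeq_refl.
- exact: oeq_nadd (oeq_refl a) IH.
- apply: oeq_trans (naddA _ _ _) _; apply: oeq_trans (oeq_sym (naddA _ _ _)).
  exact: oeq_nadd (naddC _ _) (oeq_refl _).
- exact: oeq_trans IH1 IH2.
Qed.

Lemma oge_trans : Relations_1.Transitive oge.
Proof. by move=> a b c ab bc; apply: ole_trans bc ab. Qed.

Lemma cnf_val_le_omuln a s : List.Forall (oge a) s ->
  ole (cnf_val s) (omuln (oexpw a) (size s)).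
Proof.
elim=> {s} [|b s ab _ IH]; first exact: ole_refl.
exact: ole_oadd (ole_oexpw ab) IH.
Qed.

(** Repeated use of [nadd_oexpw_absorb]: a sum of powers in non-increasing order is
    already a natural sum.  As natural sums do not depend on the order, this
    gives access to [hadd], which sorts the exponents. *)
Lemma cnf_val_nsum s : Sorted oge s -> oeq (cnf_val s) (nsum (map oexpw s)).
Proof.
move/(Sorted_StronglySorted oge_trans); elim=> {s} [|a s _ IH /cnf_val_le_omuln ge_a].
  exact: oeq_refl.
apply: (@oeq_trans (nadd (oexpw a) (cnf_val s))); last exact: oeq_nadd (oeq_refl _) IH.
split; [exact: ole_oadd_nadd|exact: nadd_oexpw_absorb ge_a].
Qed.

Lemma hadd_nadd a b : oeq (hadd a b) (nadd a b).
Proof.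
have [sa Ea] := cnfP a; have [sb Eb] := cnfP b.
apply: oeq_trans (cnf_val_nsum (osort_sorted _)) _.
apply: (@oeq_trans (nsum (map oexpw (cnf a ++ cnf b)))).
  exact: nsum_perm (Permutation_map oexpw (osort_perm _)).
rewrite map_cat; apply: oeq_trans (nsum_cat _ _) _.
by apply: oeq_nadd; apply: oeq_sym; [apply: oeq_trans Ea _|apply: oeq_trans Eb _];
  apply: cnf_val_nsum.
Qed.

Lemma hmul_nsum a b :
  oeq (hmul a b) (nsum [seq oexpw (hadd x y) | x <- cnf a, y <- cnf b]).
Proof.
rewrite /hmul; elim: [seq _ | x <- _, y <- _] => [|c s IH]; first exact: oeq_refl.
apply: oeq_trans (hadd_nadd _ _) _; exact: oeq_nadd (oeq_refl c) IH.
Qed.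

Lemma nadd_cnf_absorb s c r : StronglySorted oge s -> List.Forall (oge^~ c) s ->
  ole r (oexpw c) -> ole (nadd (cnf_val s) r) (oadd (cnf_val s) r).
Proof.
move=> sorted_s; elim: sorted_s => {s} [|a s _ IH ge_a] ge_c rc.
  apply: ole_trans (nadd0 r).1 _; exact: (oadd0l r).2.
have ac : oge a c by exact: List.Forall_inv ge_c.
have /IH{}IH := List.Forall_inv_tail ge_c.
apply: ole_trans (oaddA _ _ _).1.
apply: ole_trans (ole_nadd (ole_oadd_nadd _ _) (ole_refl r)) _.
apply: ole_trans (naddA _ _ _).2 _.
apply: ole_trans (ole_nadd (ole_refl _) (IH rc)) _.
apply: (@nadd_oexpw_absorb _ _ (size s).+1).
apply: ole_trans (omulnSr _ _).2; apply: ole_oadd (cnf_val_le_omuln ge_a) _.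
exact: ole_trans rc (ole_oexpw ac).
Qed.
Lemma cnf_val_rcons s c :
  oeq (cnf_val (rcons s c)) (oadd (cnf_val s) (oexpw c)).
Proof.
elim: s => [|a s [IH1 IH2]].
  by apply: oeq_trans (oadd0 _) _; apply: oeq_sym; apply: oadd0l.
apply: oeq_trans (oaddA _ _ _).
by split; apply: ole_add.
Qed.

Lemma omuln_oexpw a n : omuln (oexpw a) n = cnf_val (nseq n a).
Proof. by elim: n => //= n <-. Qed.

(** Indexing the exponents by [I], rather than only bounding them, suits the
    structural inductions on exponents below. *)
Lemma olt_oexpw_sup I (f : I -> Ord) c : olt c (oexpw (osup f)) ->
  exists s : seq I, ole c (cnf_val (map f s)).
Proof.
case=> -[[i n]|] H; last by exists [::].
by exists (nseq n i); rewrite map_nseq -omuln_oexpw.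
Qed.

Lemma nsum_lt I (h : I -> Ord) w s : nadd_closed w -> olt ozero w ->
  (forall i, olt (h i) w) -> olt (nsum (map h s)) w.
Proof. by move=> Hw w0 hw; elim: s => // i s IH; apply: Hw. Qed.

Lemma Sorted_rcons_inv s c : StronglySorted oge (rcons s c) ->
  StronglySorted oge s /\ List.Forall (oge^~ c) s.
Proof.
elim: s => [|a s IH] H; first by split; constructor.
have [/IH [sorted_s ge_c] ge_a] := StronglySorted_inv H.
suff [? ?] : List.Forall (oge a) s /\ oge a c by split; constructor.
elim: s ge_a {IH H sorted_s ge_c} => [|b s IH] H.
  by split; [constructor|apply: List.Forall_inv H].
have [? ?] := IH (List.Forall_inv_tail H).
by split=> //; constructor=> //; apply: List.Forall_inv H.
Qed.

(** There is no bound on [j]: the default value [ozero] lies below all entries. *)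
Lemma ole_nth_sorted s i j : StronglySorted oge s -> (i <= j)%N ->
  ole (nth ozero s j) (nth ozero s i).
Proof.
move=> sorted_s; elim: sorted_s i j => {s} [|a s _ IH ge_a] i j.
  by rewrite !nth_nil => _; apply: ole_refl.
case: j i => [|j] [|i] //= ij; [exact: ole_refl| |exact: IH].
elim: s ge_a j {IH ij} => [|b s IH] H j; first by rewrite nth_nil; apply: ole0.
case: j => [|j] /=; first exact: List.Forall_inv H.
exact: IH (List.Forall_inv_tail H) j.
Qed.

Lemma StronglySorted_nseq n a : StronglySorted oge (nseq n a).
Proof.
elim: n => [|n IH]; constructor=> //.
by elim: n {IH} => [|n IH]; constructor=> //; apply: ole_refl.
Qed.

Lemma nsum_map_perm (T : eqType) (g : T -> Ord) s t :
  perm_eq s t -> oeq (nsum (map g s)) (nsum (map g t)).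
Proof.
move=> st; apply: nsum_perm; move: st.
move/(catCA_perm_ind (P := fun u => Permutation (map g s) (map g u))).
apply; last exact: Permutation_refl.
move=> s1 s2 s3 H; apply: Permutation_trans H _; rewrite !map_cat.
exact: Permutation_app_swap_app.
Qed.

Lemma nsum_allpairs I J (h : I -> J -> Ord) s t :
  oeq (nsum [seq h x y | x <- s, y <- t])
      (nsum [seq nsum [seq h x y | y <- t] | x <- s]).
Proof.
elim: s => [|x s IH]; first exact: oeq_refl.
rewrite allpairs_cons; apply: oeq_trans (nsum_cat _ _) _.
exact: oeq_nadd (oeq_refl _) IH.
Qed.


(** * Ranks and statures of subsets *)

Section RankTheory.
Variables (P : Type) (lt : P -> P -> Prop) (wf : well_founded lt).

Lemma rk_lt x y : lt x y -> olt (rk wf x) (rk wf y).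
Proof. by move=> xy; rewrite (rkE wf y); apply: (olt_sup _ (exist _ x xy)). Qed.

Lemma olt_rk c y : olt c (rk wf y) -> exists2 x, lt x y & ole c (rk wf x).
Proof. by rewrite rkE => -[[x xy] /= H]; exists x. Qed.

(** A rank has no gaps: ranks of smaller elements form an initial segment. *)
Lemma rk_hit : (forall x y z, lt x y -> lt y z -> lt x z) ->
  forall c y, olt c (rk wf y) -> exists2 x, lt x y & oeq c (rk wf x).
Proof.
move=> lt_trans c; elim/(well_founded_ind wf) => y IH /olt_rk [x xy cx].
have [xc|/(IH x xy) [z zx E]] := ole_lt (rk wf x) c; first by exists x.
by exists z => //; apply: lt_trans xy.
Qed.
End RankTheory.

Lemma rk_sim P lt (wf : @well_founded P lt) Q lt' (wf' : @well_founded Q lt')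
    (R : P -> Q -> Prop) :
  (forall x y x', R x y -> lt x' x -> exists2 y', lt' y' y & R x' y') ->
  forall x y, R x y -> ole (rk wf x) (rk wf' y).
Proof.
move=> sim; elim/(well_founded_ind wf) => x IH y xy.
rewrite (rkE wf); apply/oleP => -[x' x'x] /=.
have [y' y'y x'y'] := sim _ _ _ xy x'x.
exact: ole_lt_trans (IH _ x'x _ x'y') (rk_lt wf' y'y).
Qed.

Definition closed_in (X : topologicalType) (A C : set X) : Prop :=
  exists2 F, closed F & C = A `&` F.

(** Ranking all subsets at once by this relation gives every subset the stature of
    its subspace topology without forming the subspace as a type; subspaces of
    different sets can then be compared and cut inside one well-founded order. *)
Definition closed_lt (X : topologicalType) (C A : set X) : Prop :=
  closed_in A C /\ ~ A `<=` C.

Section Stature.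
Variables (X : topologicalType).
Implicit Types A B C F : set X.

Lemma closed_in_sub A C : closed_in A C -> C `<=` A.
Proof. by move=> [F _ ->] x []. Qed.

Lemma closed_in_trans A B C : closed_in A B -> closed_in B C -> closed_in A C.
Proof.
by move=> [F cF ->] [G cG ->]; exists (F `&` G); [apply: closedI|rewrite setIA].
Qed.

Lemma closed_in0 A : closed_in A set0.
Proof. by exists set0; rewrite ?setI0 //; apply: closed0. Qed.

Lemma closed_in_refl A : closed_in A A.
Proof. by exists setT; rewrite ?setIT //; apply: closedT. Qed.

Lemma closed_lt_trans A B C : closed_lt A B -> closed_lt B C -> closed_lt A C.
Proof.
move=> [AB nAB] [BC nBC]; split; first exact: closed_in_trans BC AB.
move=> CA; apply: nBC; apply: subset_trans CA _; exact: closed_in_sub AB.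
Qed.

Hypothesis nX : noetherian X.

(** Taking closures embeds the order into that of the closed sets of the space:
    a relatively closed subset is recovered from its closure. *)
Lemma closed_lt_wf : well_founded (@closed_lt X).
Proof.
pose cl A : hoare X := exist _ (closure A) (@closed_closure X A).
apply: (wf_incl _ _ (fun A B => hoare_lt (cl A) (cl B)));
  last exact: wf_inverse_image (hoare_wf nX).
move=> C A [[F cF CE] AC]; split; first by apply: closureS; rewrite CE.
move=> clAC; apply: AC => x Ax; rewrite CE; split=> //; apply: cF.
have : closure C x by apply/clAC/subset_closure.
by apply: closureS; rewrite CE.
Qed.

Definition stat A := rk closed_lt_wf A.

Lemma stat_setT : oeq (stat setT) (stature nX).
Proof.
rewrite /stat /stature; split.
  apply: (@rk_sim _ _ _ _ _ _ (fun (A : set X) (F : hoare X) => A = sval F)) => // A F C -> [CF FC].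
  have cC : closed C.
    by case: CF => G cG ->; apply: closedI => //; apply: svalP.
  by exists (exist _ C cC) => //; split=> //; apply: closed_in_sub CF.
apply: (@rk_sim _ _ _ _ _ _ (fun (F : hoare X) (A : set X) => A = sval F)) => // F A G -> [GF FG].
exists (sval G) => //; split=> //; exists (sval G); first exact: svalP.
by rewrite setIC; apply/esym/setIidPl.
Qed.

Lemma stat_lt C A : closed_lt C A -> olt (stat C) (stat A).
Proof. exact: rk_lt. Qed.

Lemma olt_stat c A : olt c (stat A) ->
  exists2 C, closed_lt C A & oeq c (stat C).
Proof. by apply: rk_hit => *; apply: closed_lt_trans; eauto. Qed.

Lemma ole_stat A c :
  (forall C, closed_lt C A -> olt (stat C) c) -> ole (stat A) c.
Proof. by rewrite /stat rkE => H; apply/oleP => -[C CA]; apply: H. Qed.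

(** If [F] cuts a proper part out of [A], it cuts a proper part out of [B]. *)
Lemma stat_mono A B : A `<=` B -> ole (stat A) (stat B).
Proof.
apply: (@rk_sim _ _ _ _ _ _ (fun A B : set X => A `<=` B)) => {}A {}B C AB [[F cF ->] nAF].
exists (B `&` F); last exact: setSI.
split; first by exists F.
by move=> BF; apply: nAF => x Ax; split=> //; case: (BF _ (AB _ Ax)).
Qed.

Lemma stat_gt0 A : A !=set0 -> olt ozero (stat A).
Proof.
move=> [x Ax]; apply: ole_lt_trans (ole0 _) (stat_lt (C := set0) _).
by split; [apply: closed_in0|move/(_ x Ax)].
Qed.

Lemma stat0 c : ole (stat set0) c.
Proof. by apply: ole_stat => C [_ []]. Qed.

(** A closed set that omits a point of the union leaves one of the two traces
    proper, and the natural sum is strictly increasing in each argument. *)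
Lemma statU A B : ole (stat (A `|` B)) (nadd (stat A) (stat B)).
Proof.
suff H S : forall A B, S = A `|` B -> ole (stat S) (nadd (stat A) (stat B)).
  exact: H.
elim/(well_founded_ind closed_lt_wf): S => S IH {}A {}B SE.
apply: ole_stat => C CS; have [[F cF CE] nSC] := CS.
have CU : C = (A `&` F) `|` (B `&` F) by rewrite CE SE setIUl.
have leF D : ole (stat (D `&` F)) (stat D) by apply: stat_mono.
apply: ole_lt_trans (IH C CS _ _ CU) _.
have [AF|AF] := pselect (A `<=` A `&` F).
  apply: ole_lt_trans (ole_nadd (leF A) (ole_refl _)) _.
  apply: olt_naddr; apply: stat_lt; split; first by exists F.
  by move=> BF; apply: nSC; rewrite CU SE; apply: setUSS.
apply: olt_le_trans (ole_nadd (ole_refl _) (leF B)).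
by apply: olt_naddl; apply: stat_lt; split=> //; exists F.
Qed.

(** First climb through the closed subsets of [C], then through the closed sets
    between [C] and [A], which are the closed subsets of the complement. *)
Lemma stat_closed_add A C : closed_in A C ->
  ole (oadd (stat C) (stat (A `\` C))) (stat A).
Proof.
suff H B : forall A C, closed_in A C -> B = A `\` C ->
    ole (oadd (stat C) (stat B)) (stat A) by move=> AC; apply: H.
elim/(well_founded_ind closed_lt_wf): B => B IH {}A {}C CA BE.
have CsubA := closed_in_sub CA.
suff key b : olt b (oadd (stat C) (stat B)) -> olt b (stat A).
  by have [//|/key/olt_irr] := ole_lt (oadd (stat C) (stat B)) (stat A).
case/olt_oadd_inv => [bC|[b' /olt_stat [D DB [bD _]] bb']].
  exact: olt_le_trans bC (stat_mono CsubA).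
have [[F cF DE] nBD] := DB; have [G cG CE] := CA.
have AD : closed_in A (C `|` D).
  exists (F `|` G); first exact: closedU.
  rewrite DE BE; apply/seteqP; split=> x.
    by case=> [Cx|[[Ax _] Fx]]; split=> //; [exact: CsubA|right; move: Cx; rewrite CE => -[]|left].
  move=> [Ax FGx]; have [Cx|nCx] := pselect (C x); first by left.
  by right; split=> //; case: FGx => // Gx; case: nCx; rewrite CE.
have CD : closed_in (C `|` D) C.
  exists G => //; rewrite DE BE; apply/seteqP; split=> x.
    by move=> Cx; split; [left|move: Cx; rewrite CE => -[]].
  by move=> [[//|[[Ax nCx] _]] Gx]; case: nCx; rewrite CE.
have DD : D = (C `|` D) `\` C.
  apply/seteqP; split=> x; last by move=> [[]].
  by rewrite DE BE => -[[Ax nCx] Fx]; split=> //; right; split.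
apply: ole_lt_trans bb' _; apply: ole_lt_trans (ole_add _ bD) _.
apply: ole_lt_trans (IH D DB _ _ CD DD) _; apply: stat_lt; split=> //.
move=> ACD; apply: nBD => x; rewrite BE => -[Ax nCx].
by case: (ACD _ Ax).
Qed.

(** A relatively closed [C] whose stature is exactly [a] exists unless the stature
    of [A] is at most [a]; its complement is small by [stat_closed_add]. *)
Lemma stat_split A a b : ole (stat A) (oadd a b) ->
  exists C, [/\ closed_in A C, ole (stat C) a & ole (stat (A `\` C)) b].
Proof.
move=> Aab; have [Aa|/olt_stat [C [CA _] [aC Ca]]] := ole_lt (stat A) a.
  exists A; split=> //; first exact: closed_in_refl.
  by rewrite setDv; apply: stat0.
exists C; split=> //; apply: (@ole_add_cancel (stat C)).
apply: ole_trans (stat_closed_add CA) _; apply: ole_trans Aab _.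
exact: ole_oadd aC (ole_refl b).
Qed.

End Stature.
(** * Cutting a subset along a Cantor normal form *)

Section Pieces.
Variables (X : topologicalType) (nX : noetherian X).
Implicit Types A C : set X.

(** Choose [C] of stature exactly [cnf_val s].  By subadditivity ([statU]) a
    complement of stature [r] below omega^c would give [A] a stature of at most
    the natural sum of [cnf_val s] and [r].  That is their ordinary sum, as [c]
    is the least exponent, hence too small. *)
Lemma stat_peel A s c : StronglySorted oge s -> List.Forall (oge^~ c) s ->
  ole (oadd (cnf_val s) (oexpw c)) (stat nX A) ->
  exists C, [/\ closed_in A C, ole (cnf_val s) (stat nX C)
              & ole (oexpw c) (stat nX (A `\` C))].
Proof.
move=> sorted_s ge_c sA.
have ltA : olt (cnf_val s) (stat nX A).
  exact: olt_le_trans (olt_oaddr _ (oexpw_gt0 c)) sA.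
have [C [CA _] [sC Cs]] := olt_stat ltA.
exists C; split=> //.
have [//|rc] := ole_lt (oexpw c) (stat nX (A `\` C)).
case: (@olt_irr (stat nX A)); apply: olt_le_trans sA.
rewrite -{1}(setDUK (closed_in_sub CA)).
apply: ole_lt_trans (statU _ _ _) _.
apply: ole_lt_trans (ole_nadd Cs (ole_refl _)) _.
apply: ole_lt_trans (nadd_cnf_absorb sorted_s ge_c (oltW rc)) _.
exact: olt_add.
Qed.

(** Cut [A] into pieces of stature at most omega^(f i) and add up the images.
    [Phi] stands for the product with a fixed set, on either side. *)
Lemma stat_cover_le (Z : topologicalType) (nZ : noetherian Z)
    (Phi : set X -> set Z) I (f h : I -> Ord) s A :
  (forall C D, Phi (C `|` D) `<=` Phi C `|` Phi D) -> Phi set0 = set0 ->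
  (forall i C, ole (stat nX C) (oexpw (f i)) -> ole (stat nZ (Phi C)) (h i)) ->
  ole (stat nX A) (cnf_val (map f s)) ->
  ole (stat nZ (Phi A)) (nsum (map h s)).
Proof.
move=> PhiU Phi0 Hh; elim: s A => [|i s IH] A.
  move=> A0; have -> : A = set0.
    apply: contrapT => /eqP/set0P/(stat_gt0 nX)/olt_le_trans/(_ A0).
    exact: olt_irr.
  by rewrite Phi0; apply: stat0.
case/stat_split => C [CA /Hh Ci /IH Cs].
rewrite -(setDUK (closed_in_sub CA)).
apply: ole_trans (stat_mono nZ (PhiU _ _)) _.
exact: ole_trans (statU _ _ _) (ole_nadd Ci Cs).
Qed.

(** Dual to [stat_cover_le]: here the images must remain relatively closed, so
    that [stat_closed_add] applies to them. *)
Lemma stat_omuln_ge (Z : topologicalType) (nZ : noetherian Z)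
    (Phi : set X -> set Z) a h n A :
  (forall A C, closed_in A C -> closed_in (Phi A) (Phi C)) ->
  (forall A C, Phi (A `\` C) `<=` Phi A `\` Phi C) ->
  (forall C, ole (oexpw a) (stat nX C) -> ole h (stat nZ (Phi C))) ->
  ole (omuln (oexpw a) n) (stat nX A) -> ole (omuln h n) (stat nZ (Phi A)).
Proof.
move=> PhiC PhiD Hh; elim: n A => [|n IH] A H; first exact: ole0.
have [C [CA nC aD]] : exists C, [/\ closed_in A C,
    ole (omuln (oexpw a) n) (stat nX C) & ole (oexpw a) (stat nX (A `\` C))].
  rewrite omuln_oexpw; apply: stat_peel.
  - exact: StronglySorted_nseq.
  - by elim: n {IH H} => [|n IH]; constructor=> //; apply: ole_refl.
  - by rewrite -omuln_oexpw; apply: ole_trans (omulnSr _ _).2 H.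
apply: ole_trans (omulnSr _ _).1 _.
apply: ole_trans (stat_closed_add nZ (PhiC _ _ CA)).
apply: ole_oadd; first exact: IH.
apply: ole_trans (Hh _ aD) _; apply: stat_mono; exact: PhiD.
Qed.

(** The function [p] numbers the pieces in the order of the terms of [s]: initial
    unions of pieces are relatively closed, and the i-th piece has at least the
    stature of the i-th term. *)
Lemma stat_pieces A s : StronglySorted oge s -> ole (cnf_val s) (stat nX A) ->
  exists p : X -> nat,
    (forall i, closed_in A [set x | A x /\ (p x < i)%N]) /\
    (forall i, (i < size s)%N ->
       ole (oexpw (nth ozero s i)) (stat nX [set x | A x /\ p x = i])).
Proof.
elim/last_ind: s A => [|s c IH] A.
  move=> _ _; exists (fun=> 0); split=> // -[|i].
    have -> : [set x | A x /\ (0 < 0)%N] = set0 by apply/seteqP; split=> x // [].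
    exact: closed_in0.
  have -> : [set x | A x /\ (0 < i.+1)%N] = A by apply/seteqP; split=> x // [].
  exact: closed_in_refl.
move=> /Sorted_rcons_inv [sorted_s ge_c] sA.
have [C [CA sC cD]] := stat_peel sorted_s ge_c (ole_trans (cnf_val_rcons s c).2 sA).
have CsubA := closed_in_sub CA.
have [p [p_closed p_stat]] := IH C sorted_s sC.
(* Points that [p] numbers beyond the pieces of [C] join the new, last piece. *)
exists (fun x => if pselect (C x) then minn (p x) (size s) else size s); split=> i.
  have [si|le_is] := ltnP (size s) i.
    rewrite (_ : [set x | _] = A); first exact: closed_in_refl.
    apply/seteqP; split=> x /=; first by case.
    move=> Ax; split=> //; case: (pselect (C x)) => //= _; exact: leq_ltn_trans (geq_minr _ _) si.
  apply: closed_in_trans CA _.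
  rewrite (_ : [set x | _] = [set x | C x /\ (p x < i)%N]) //.
  apply/seteqP; split=> x /= [].
    case: (pselect (C x)) => /= [Cx _|_ _]; last by rewrite ltnNge le_is.
    by rewrite gtn_min [(size s < i)%N]ltnNge le_is orbF.
  move=> Cx px; split; first exact: CsubA.
  by case: (pselect (C x)) => //= _; rewrite gtn_min px.
rewrite size_rcons ltnS nth_rcons leq_eqVlt => /orP [/eqP ->|lt_is].
  rewrite ltnn eqxx; apply: ole_trans cD _; apply: stat_mono => x [Ax nCx] /=.
  by split=> //; case: (pselect (C x)).
rewrite lt_is; apply: ole_trans (p_stat i lt_is) _; apply: stat_mono => x [Cx px] /=.
split; first exact: CsubA.
by case: (pselect (C x)) => //= _; rewrite px; apply/minn_idPl/ltnW.
Qed.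

End Pieces.

(** * Products *)

(** A list of pairs in which [not_below e f] holds whenever [e] precedes [f] is one
    in which no pair is preceded by one that dominates it.  If it enumerates a
    rectangle, its initial segments are staircases. *)
Definition not_below (e f : nat * nat) := ~~ ((f.1 <= e.1) && (f.2 <= e.2))%N.

(** Sorting by decreasing weight makes the ordinary sum of the weights a natural
    one.  Ties are broken by the sum of the two coordinates: a pair dominated by
    another has at least its weight and a smaller coordinate sum, so it comes
    first. *)
Lemma staircase_order (w : nat * nat -> Ord) (l : seq (nat * nat)) : uniq l ->
  (forall e f : nat * nat, (f.1 <= e.1)%N -> (f.2 <= e.2)%N -> ole (w e) (w f)) ->
  exists l', [/\ perm_eq l' l, Sorted oge (map w l') & pairwise not_below l'].
Proof.
move=> uniq_l w_anti.
pose r (e f : nat * nat) : bool := `[< olt (w f) (w e) \/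
  ole (w f) (w e) /\ (e.1 + e.2 <= f.1 + f.2)%N >].
have r_le e f : r e f -> ole (w f) (w e) by move/asboolP => [/oltW|[]].
have r_total : total r.
  move=> e f; have [ef|fe] := ole_lt (w e) (w f); last first.
    by apply/orP; left; apply/asboolP; left.
  have [fe|ef'] := ole_lt (w f) (w e); last first.
    by apply/orP; right; apply/asboolP; left.
  by case/orP: (leq_total (e.1 + e.2) (f.1 + f.2)) => H; apply/orP;
    [left|right]; apply/asboolP; right.
have r_trans : transitive r.
  move=> f e g /asboolP ef /asboolP fg; apply/asboolP.
  case: ef fg => [ef|[ef ef']] [fg|[fg fg']].
  - by left; apply: olt_le_trans fg (oltW ef).
  - by left; apply: ole_lt_trans fg ef.
  - by left; apply: olt_le_trans fg ef.
  - by right; split; [apply: ole_trans fg ef|apply: leq_trans ef' fg'].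
have sorted_l := sort_sorted r_total l.
exists (sort r l); split; first by rewrite perm_sort.
  elim: (sort r l) sorted_l => [|e [|f s] IH] /=; try by repeat constructor.
  by move=> /andP [/r_le ef /IH fs]; constructor=> //; constructor.
move: sorted_l; rewrite (sorted_pairwise r_trans).
have : uniq (sort r l) by rewrite sort_uniq.
elim: (sort r l) => //= e s IH /andP [es us] /andP [/allP re /(IH us) ->].
rewrite andbT; apply/allP => f fs; apply/negP => /andP [f1 f2].
have /asboolP [|[_ ef]] := re f fs; first by move/oltNge; apply; apply: w_anti.
have E : f = e.
  by case: e f {IH es re fs} f1 f2 ef => e1 e2 [f1 f2] /= ? ? ?; congr pair; lia.
by move: es; rewrite -E fs.
Qed.

Section Product.
Variables (X Y : topologicalType) (nX : noetherian X) (nY : noetherian Y).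
Let nXY := noetherian_prod nX nY.

Lemma closed_fst (F : set X) : closed F -> closed (F `*` [set: Y]).
Proof.
move=> cF; rewrite (_ : _ `*` _ = fst @^-1` F); last first.
  by apply/seteqP; split=> z //= [].
by apply: preimage_closed => // z _; apply: cvg_fst.
Qed.

Lemma closed_snd (G : set Y) : closed G -> closed ([set: X] `*` G).
Proof.
move=> cG; rewrite (_ : _ `*` _ = snd @^-1` G); last first.
  by apply/seteqP; split=> z //= [].
by apply: preimage_closed => // z _; apply: cvg_snd.
Qed.

Lemma closed_in_setXl (B : set Y) (A C : set X) :
  closed_in A C -> closed_in (A `*` B) (C `*` B).
Proof.
move=> [F cF ->]; exists (F `*` [set: Y]); first exact: closed_fst.
by apply/seteqP; split=> z /=; tauto.
Qed.

Lemma closed_in_setXr (A : set X) (B D : set Y) :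
  closed_in B D -> closed_in (A `*` B) (A `*` D).
Proof.
move=> [G cG ->]; exists ([set: X] `*` G); first exact: closed_snd.
by apply/seteqP; split=> z /=; tauto.
Qed.

(** A point of the product outside the closed set has a basic open neighbourhood
    U x V disjoint from it; remove [U] from [A] and [V] from [B]. *)
Lemma closed_lt_setX (A : set X) (B : set Y) D : closed_lt D (A `*` B) ->
  exists C E, [/\ closed_lt C A, closed_lt E B & D `<=` (C `*` B) `|` (A `*` E)].
Proof.
move=> [[F cF DE] nD].
have [[x y] [[Ax By] nF]] : exists z, (A `*` B) z /\ ~ F z.
  apply: contrapT => H; apply: nD => z ABz; rewrite DE; split=> //.
  by apply: contrapT => nFz; apply: H; exists z.
have : nbhs (x, y) (~` F) by apply: open_nbhs_nbhs; split=> //; apply: closed_openC.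
case=> -[U V] /= [+ +] UVF; rewrite !nbhsE => -[U' [oU' U'x] U'U] [V' [oV' V'y] V'V].
exists (A `&` ~` U'), (B `&` ~` V'); split.
- by split; [exists (~` U') => //; apply: open_closedC|move/(_ x Ax) => -[_]].
- by split; [exists (~` V') => //; apply: open_closedC|move/(_ y By) => -[_]].
- move=> [x' y']; rewrite DE => -[[/= Ax' By'] Fz].
  have [U'x'|] := pselect (U' x'); last by left.
  right; split=> //; split=> //= V'y'.
  by apply: (UVF (x', y')) Fz; split; [apply: U'U|apply: V'V].
Qed.

(** By [closed_lt_setX] a proper relatively closed subset is covered by two
    products in which one factor has dropped below its power of omega.  Cutting
    that factor into finitely many pieces of lower exponent, each covered by
    the induction hypothesis, bounds both products by ordinals below
    omega^(nadd a b), which is closed under natural sums. *)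
Lemma stat_setX_le a b (A : set X) (B : set Y) :
  ole (stat nX A) (oexpw a) -> ole (stat nY B) (oexpw b) ->
  ole (stat nXY (A `*` B)) (oexpw (nadd a b)).
Proof.
elim: a b A B => I f IHa; elim=> J g IHb A B Aa Bb.
apply: ole_stat => D /closed_lt_setX [C [E [CA EB sub]]].
apply: ole_lt_trans (stat_mono nXY sub) _.
apply: ole_lt_trans (statU _ _ _) _.
have w0 := oexpw_gt0 (nadd (osup f) (osup g)).
have ltw c : olt c (nadd (osup f) (osup g)) ->
    olt (oexpw c) (oexpw (nadd (osup f) (osup g))).
  by move=> H; apply: ole_lt_trans (omuln1 _).2 (olt_oexpw_omuln 1 H).
apply: (@nadd_closed_oexpw _ _ _).
  have /olt_oexpw_sup [s Cs] := olt_le_trans (stat_lt nX CA) Aa.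
  apply: (@ole_lt_trans (nsum [seq oexpw (nadd (f i) (osup g)) | i <- s])).
    apply: (stat_cover_le (Phi := fun C => C `*` B) _ _ _ Cs).
    - by move=> C1 C2 z [[]]; [left|right].
    - by apply/seteqP; split=> z // [].
    - by move=> i C1 C1i; apply: IHa.
  apply: nsum_lt => //; first exact: nadd_closed_oexpw.
  by move=> i; apply: ltw; apply: olt_naddl; apply: olt_sup.
have /olt_oexpw_sup [s Es] := olt_le_trans (stat_lt nY EB) Bb.
apply: (@ole_lt_trans (nsum [seq oexpw (nadd (osup f) (g j)) | j <- s])).
  apply: (stat_cover_le (Phi := fun E => A `*` E) _ _ _ Es).
  - by move=> C1 C2 z [? []]; [left|right].
  - by apply/seteqP; split=> z // [].
  - by move=> j E1 E1j; apply: IHb.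
apply: nsum_lt => //; first exact: nadd_closed_oexpw.
by move=> j; apply: ltw; apply: olt_naddr; apply: olt_sup.
Qed.

(** An ordinal below omega^(nadd a b) is at most omega^(nadd a' b) * n with a' < a,
    or symmetrically.  Since omega^a' * (n + 1) still fits into [A], the product
    contains n + 1 successive pieces of stature at least omega^(nadd a' b). *)
Lemma stat_setX_ge a b (A : set X) (B : set Y) :
  ole (oexpw a) (stat nX A) -> ole (oexpw b) (stat nY B) ->
  ole (oexpw (nadd a b)) (stat nXY (A `*` B)).
Proof.
elim: a b A B => I f IHa; elim=> J g IHb A B Aa Bb.
have nonempty (Z : topologicalType) (nZ : noetherian Z) (C : set Z) c :
    ole (oexpw c) (stat nZ C) -> C !=set0.
  move=> cC; apply/set0P/eqP => C0; apply: (@olt_irr ozero).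
  apply: olt_le_trans (oexpw_gt0 c) _; apply: ole_trans cC _.
  by rewrite C0; apply: stat0.
apply/oleP => -[[[i|j] n]|].
- apply: (@olt_le_trans (omuln (oexpw (nadd (f i) (osup g))) n.+1)).
    exact: olt_le_trans (olt_oaddr _ (oexpw_gt0 _)) (omulnSr _ _).2.
  apply: (stat_omuln_ge (nX := nX) (Phi := fun C => C `*` B) (a := f i)).
  + by move=> A1 C; apply: closed_in_setXl.
  + by move=> A1 C z [[? nC] ?]; split=> // -[].
  + by move=> C Ci; apply: IHa.
  + apply: ole_trans Aa; apply: oltW; apply: olt_oexpw_omuln; exact: olt_sup.
- apply: (@olt_le_trans (omuln (oexpw (nadd (osup f) (g j))) n.+1)).
    exact: olt_le_trans (olt_oaddr _ (oexpw_gt0 _)) (omulnSr _ _).2.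
  apply: (stat_omuln_ge (nX := nY) (Phi := fun E => A `*` E) (a := g j)).
  + by move=> B1 E; apply: closed_in_setXr.
  + by move=> B1 E z [? [? nE]]; split=> // -[].
  + by move=> E Ej; apply: IHb.
  + apply: ole_trans Bb; apply: oltW; apply: olt_oexpw_omuln; exact: olt_sup.
- have [x Ax] := nonempty _ _ _ _ Aa; have [y By] := nonempty _ _ _ _ Bb.
  by apply: stat_gt0; exists (x, y).
Qed.

(** The block of the last pair [e] consists of the points that have neither
    [p < e.1] nor [q < e.2], two relatively closed conditions, and all earlier
    blocks satisfy one of them.  Hence the earlier blocks form a relatively
    closed set and [stat_closed_add] applies. *)
Lemma stat_staircase (A : set X) (B : set Y) (p : X -> nat) (q : Y -> nat)
    (w : nat * nat -> Ord) (l : seq (nat * nat)) :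
  (forall i, closed_in A [set x | A x /\ (p x < i)%N]) ->
  (forall j, closed_in B [set y | B y /\ (q y < j)%N]) ->
  {in l, forall e, ole (oexpw (w e)) (stat nXY
     ([set x | A x /\ p x = e.1] `*` [set y | B y /\ q y = e.2]))} ->
  pairwise not_below l ->
  ole (cnf_val (map w l))
    (stat nXY [set z | (A `*` B) z /\ (p z.1, q z.2) \in l]).
Proof.
move=> pA qB; elim/last_ind: l => [|l e IH] Hw; first by move=> _; apply: ole0.
rewrite pairwise_rcons => /andP [/allP le_e /IH{}IH].
have [F cF FE] := pA e.1; have [G cG GE] := qB e.2.
have inF x : A x -> F x <-> (p x < e.1)%N.
  move=> Ax; split=> [Fx|px].
    by have : (A `&` F) x by []; rewrite -FE => -[].
  by have : [set x | A x /\ (p x < e.1)%N] x by []; rewrite FE => -[].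
have inG y : B y -> G y <-> (q y < e.2)%N.
  move=> By; split=> [Gy|qy].
    by have : (B `&` G) y by []; rewrite -GE => -[].
  by have : [set y | B y /\ (q y < e.2)%N] y by []; rewrite GE => -[].
rewrite map_rcons; apply: ole_trans (cnf_val_rcons _ _).1 _.
set T' := [set z | _ /\ _ \in rcons l e].
pose T := [set z | (A `*` B) z /\ (p z.1, q z.2) \in l].
have TT' : closed_in T' T.
  exists ((F `*` [set: Y]) `|` ([set: X] `*` G)).
    by apply: closedU; [apply: closed_fst|apply: closed_snd].
  apply/seteqP; split=> -[x y] /=.
    move=> [[/= Ax By] xyl]; split.
      by split=> //=; rewrite mem_rcons inE xyl orbT.
    have := le_e _ xyl; rewrite /not_below negb_and -!ltnNge /= => /orP [px|qy].
      by left; split=> //; apply/inF.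
    by right; split=> //; apply/inG.
  move=> [[[/= Ax By]]]; rewrite mem_rcons inE => /orP [/eqP E|//].
  by case=> -[/= Fx Gy]; [move/(inF x Ax): Fx|move/(inG y By): Gy];
    rewrite -E /= ltnn.
apply: ole_trans (stat_closed_add nXY TT').
apply: ole_oadd.
  by apply: IH => e' e'l; apply: Hw; rewrite mem_rcons inE e'l orbT.
apply: ole_trans (Hw e _) _; first by rewrite mem_rcons mem_head.
apply: stat_mono => -[x y] [/= [Ax px] [By qy]]; split.
  by split=> //=; rewrite px qy mem_rcons -surjective_pairing mem_head.
by case=> _ /=; rewrite px qy -surjective_pairing => /le_e; rewrite /not_below !leqnn.
Qed.

End Product.

Theorem theorem10p9 (X Y : topologicalType)
    (nX : noetherian X) (nY : noetherian Y) :
  oeq (stature (noetherian_prod nX nY)) (hmul (stature nX) (stature nY)).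
Proof.
have [sorted_s [sle sge]] := cnfP (stature nX).
have [sorted_t [tle tge]] := cnfP (stature nY).
have [lesX geX] := stat_setT nX; have [lesY geY] := stat_setT nY.
have [lesXY geXY] := stat_setT (noetherian_prod nX nY).
have [mle mge] := hmul_nsum (stature nX) (stature nY).
set s := cnf (stature nX) in sorted_s sle sge mle mge *.
set t := cnf (stature nY) in sorted_t tle tge mle mge *.
split.
  apply: ole_trans geXY _; apply: ole_trans mge.
  apply: ole_trans (nsum_allpairs _ s t).2.
  rewrite -setXTT.
  apply: (stat_cover_le (nX := nX) (f := id) (Phi := fun C => C `*` [set: Y])).
  - by move=> C1 C2 z [[]]; [left|right].
  - by apply/seteqP; split=> z // [].
  - move=> x C Cx.
    apply: (stat_cover_le (nX := nY) (f := id) (Phi := fun E => C `*` E)).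
    + by move=> C1 C2 z [? []]; [left|right].
    + by apply/seteqP; split=> z // [].
    + move=> y E Ey; apply: ole_trans (stat_setX_le Cx Ey) _.
      exact: ole_oexpw (hadd_nadd x y).2.
    + by rewrite map_id; apply: ole_trans lesY tle.
  - by rewrite map_id; apply: ole_trans lesX sle.
have ssort_s := Sorted_StronglySorted oge_trans sorted_s.
have ssort_t := Sorted_StronglySorted oge_trans sorted_t.
have [p [pC pS]] := stat_pieces ssort_s (ole_trans sge geX).
have [q [qC qS]] := stat_pieces ssort_t (ole_trans tge geY).
pose w (e : nat * nat) := hadd (nth ozero s e.1) (nth ozero t e.2).
pose L := [seq (i, j) | i <- iota 0 (size s), j <- iota 0 (size t)].
have w_anti (e f : nat * nat) : (f.1 <= e.1)%N -> (f.2 <= e.2)%N -> ole (w e) (w f).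
  move=> f1 f2; apply: ole_trans (hadd_nadd _ _).1 _.
  apply: ole_trans (hadd_nadd _ _).2.
  by apply: ole_nadd; apply: ole_nth_sorted.
have uniq_L : uniq L by apply: allpairs_uniq; rewrite ?iota_uniq // => -[? ?] [].
have [l [lL sorted_l stairs]] := staircase_order uniq_L w_anti.
apply: ole_trans mle _.
have -> : [seq oexpw (hadd x y) | x <- s, y <- t] = map (oexpw \o w) L.
  rewrite /L map_allpairs.
  rewrite -{1}(take_size s) -(map_nth_iota0 ozero (leqnn _)) allpairs_mapl.
  by rewrite -{1}(take_size t) -(map_nth_iota0 ozero (leqnn _)) allpairs_mapr.
apply: ole_trans (nsum_map_perm (oexpw \o w) lL).2 _.
rewrite map_comp; apply: ole_trans (cnf_val_nsum sorted_l).2 _.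
apply: ole_trans lesXY; apply: ole_trans (stat_staircase pC qC _ stairs) _.
  move=> e; rewrite (perm_mem lL) => /allpairsP [[i j] /= []].
  rewrite !mem_iota /= => /pS iS /qS jS ->.
  apply: ole_trans (stat_setX_ge iS jS); exact: ole_oexpw (hadd_nadd _ _).1.
exact: stat_mono.
Qed.
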